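(* Let $\Sigma=(G,\sigma)$ be a signed graph whose underlying graph $G$ is finite, simple and connected, with $n$ vertices. Then the following are equivalent: (a) $\Sigma$ is balanced; (b) $D^{\max}(\Sigma)=D^{\min}(\Sigma)$ and the largest adjacency eigenvalue of the associated signed complete graph $K^{D^{\pm}}(\Sigma)$ is $n-1$; (c) $D^{\max}(\Sigma)=D^{\min}(\Sigma)$ and the adjacency spectrum of $K^{D^{\pm}}(\Sigma)$ consists of $n-1$ with multiplicity $1$ and $-1$ with multiplicity $n-1$.
   Context: A signed graph $\Sigma=(G,\sigma)$ consists of an underlying graph $G=(V,E)$ and a signature $\sigma:E\to\{1,-1\}$. The sign of a path or cycle is the product of the signs of its edges. $\Sigma$ is balanced if every cycle of $\Sigma$ has sign $+1$. The adjacency matrix of a signed graph has $(u,v)$ entry $\sigma(uv)$ if $u,v$ are adjacent and $0$ otherwise; the adjacency eigenvalues and adjacency spectrum (with multiplicities) are those of this matrix. Let $d(u,v)$ be the usual graph distance in $G$. For vertices $u,v$, let $\sigma_{\max}(u,v)=-1$ if all shortest $uv$-paths have sign $-1$, and $\sigma_{\max}(u,v)=+1$ otherwise; let $\sigma_{\min}(u,v)=+1$ if all shortest $uv$-paths have sign $+1$, and $\sigma_{\min}(u,v)=-1$ otherwise. Put $d_{\max}(u,v)=\sigma_{\max}(u,v)\,d(u,v)$ and $d_{\min}(u,v)=\sigma_{\min}(u,v)\,d(u,v)$. The signed distance matrices are $D^{\max}(\Sigma)=(d_{\max}(u,v))$ and $D^{\min}(\Sigma)=(d_{\min}(u,v))$.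 If $D^{\max}(\Sigma)=D^{\min}(\Sigma)$ (equivalently, $\sigma_{\max}=\sigma_{\min}$), the associated signed complete graph $K^{D^{\pm}}(\Sigma)$ is the signed complete graph on $V$ obtained from $\Sigma$ by keeping every edge of $\Sigma$ with its sign and joining each pair of distinct non-adjacent vertices $u,v$ by an edge of sign $\sigma_{\max}(u,v)=\sigma_{\min}(u,v)$. *)

(* Defs.v *)
From mathcomp Require Import all_boot all_order all_algebra.

Set Implicit Arguments.
Unset Strict Implicit.
Unset Printing Implicit Defensive.

Import Order.TTheory GRing.Theory Num.Theory.
Local Open Scope ring_scope.

(* The values of [sgn] on pairs of non-adjacent vertices are irrelevant. *)
Record signed_graph (V : finType) := SignedGraph {
  adj : rel V;
  sgn : V -> V -> int;
  adj_sym : symmetric adj;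
  adj_irr : irreflexive adj;
  sgn_sym : forall u v, adj u v -> sgn u v = sgn v u;
  sgn_pm1 : forall u v, adj u v -> sgn u v = 1 \/ sgn u v = -1 }.

Section SignedGraphs.
Variables (V : finType) (S : signed_graph V).
Implicit Types (u v : V) (p c : seq V).

(* Paths are given by their start u and the list p of the later vertices. *)
Definition is_path u v p : bool :=
  [&& path (adj S) u p, uniq (u :: p) & last u p == v].

Definition path_sign u p : int := \prod_(s <- pairmap (sgn S) u p) s.

Definition is_cycle c : bool := [&& 2 < size c, cycle (adj S) c & uniq c]%N.

Definition cycle_sign c : int := \prod_(x <- c) sgn S x (next c x).

Definition balanced : Prop := forall c, is_cycle c -> cycle_sign c = 1.

Definition connected : Prop :=
  (0 < #|V|)%N /\ forall u v, exists p, is_path u v p.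

Definition has_path_of_length u v (k : nat) : bool :=
  [exists p : k.-tuple V, is_path u v p].

(* A path has at most #|V| - 1 edges; the value is #|V| if u and v are
   not joined by any path. *)
Definition dist u v : nat := find (has_path_of_length u v) (iota 0 #|V|).

Definition all_shortest_sign u v (s : int) : bool :=
  [forall p : (dist u v).-tuple V, is_path u v p ==> (path_sign u p == s)].

Definition sigma_max u v : int := if all_shortest_sign u v (-1) then -1 else 1.
Definition sigma_min u v : int := if all_shortest_sign u v 1 then 1 else -1.

Definition d_max u v : int := sigma_max u v * (dist u v)%:Z.
Definition d_min u v : int := sigma_min u v * (dist u v)%:Z.

Definition Dmax : 'M[int]_#|V| :=
  \matrix_(i, j) d_max (enum_val i) (enum_val j).
Definition Dmin : 'M[int]_#|V| :=
  \matrix_(i, j) d_min (enum_val i) (enum_val j).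

Definition adjacency_matrix (R : pzRingType) : 'M[R]_#|V| :=
  \matrix_(i, j) (if adj S (enum_val i) (enum_val j)
                  then (sgn S (enum_val i) (enum_val j))%:~R else 0).

Lemma is_path_rev u v p :
  is_path u v p -> is_path v u (rev (belast u p)).
Proof.
case/and3P=> pp up /eqP lp; apply/and3P; split.
- rewrite -lp rev_path (eq_path (e' := adj S)) // => x y.
  by rewrite /= adj_sym.
- have -> : v :: rev (belast u p) = rev (u :: p).
    by rewrite (lastI u p) rev_rcons lp.
  by rewrite rev_uniq.
- case: p pp up lp => [|x p] _ _ /=; first by move=> ->.
  by rewrite rev_cons last_rcons.
Qed.

Lemma path_sign_cons u x p : path_sign u (x :: p) = sgn S u x * path_sign x p.
Proof. by rewrite /path_sign /= big_cons. Qed.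

Lemma path_sign_rcons u p x :
  path_sign u (rcons p x) = path_sign u p * sgn S (last u p) x.
Proof.
elim: p u => [|y p IH] u /=.
  by rewrite path_sign_cons /path_sign /= big_nil mulr1 mul1r.
by rewrite !path_sign_cons IH mulrA.
Qed.

Lemma path_sign_rev u p : path (adj S) u p ->
  path_sign (last u p) (rev (belast u p)) = path_sign u p.
Proof.
elim: p u => [|x p IH] u //= /andP[ux px].
rewrite rev_cons path_sign_rcons IH // path_sign_cons mulrC.
suff -> : last (last x p) (rev (belast x p)) = x by rewrite (sgn_sym ux).
by case: p {IH px} => //= y p; rewrite rev_cons last_rcons.
Qed.

Lemma has_path_of_length_sym u v k :
  has_path_of_length u v k = has_path_of_length v u k.
Proof.
suff H x y : has_path_of_length x y k -> has_path_of_length y x k.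
  by apply/idP/idP; apply: H.
case/existsP=> p /is_path_rev pp; apply/existsP.
have sp : size (rev (belast x p)) == k by rewrite size_rev size_belast size_tuple.
by exists (Tuple sp).
Qed.

Lemma dist_sym u v : dist u v = dist v u.
Proof. by apply: eq_find => k; apply: has_path_of_length_sym. Qed.

Lemma all_shortest_sign_sym u v s :
  all_shortest_sign u v s = all_shortest_sign v u s.
Proof.
suff H x y : all_shortest_sign x y s -> all_shortest_sign y x s.
  by apply/idP/idP; apply: H.
move=> /forallP H; apply/forallP => p; apply/implyP => pp.
have sp : size (rev (belast y p)) == dist x y.
  by rewrite size_rev size_belast size_tuple dist_sym.
have := H (Tuple sp); rewrite /= is_path_rev //=.
case/and3P: pp => pp _ /eqP lp.
by have := path_sign_rev pp; rewrite lp => ->.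
Qed.

Lemma sigma_max_sym u v : sigma_max u v = sigma_max v u.
Proof. by rewrite /sigma_max all_shortest_sign_sym. Qed.

Lemma sigma_max_pm1 u v : sigma_max u v = 1 \/ sigma_max u v = -1.
Proof. by rewrite /sigma_max; case: ifP; [right | left]. Qed.

Definition assoc_adj : rel V := fun u v => u != v.
Definition assoc_sgn u v : int :=
  if adj S u v then sgn S u v else sigma_max u v.

Lemma assoc_adj_sym : symmetric assoc_adj.
Proof. by move=> u v; rewrite /assoc_adj eq_sym. Qed.

Lemma assoc_adj_irr : irreflexive assoc_adj.
Proof. by move=> u; rewrite /assoc_adj eqxx. Qed.

Lemma assoc_sgn_sym u v : assoc_adj u v -> assoc_sgn u v = assoc_sgn v u.
Proof.
move=> _; rewrite /assoc_sgn (adj_sym S v u) (sigma_max_sym v u).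
by case: ifP => // uv; apply: sgn_sym.
Qed.

Lemma assoc_sgn_pm1 u v :
  assoc_adj u v -> assoc_sgn u v = 1 \/ assoc_sgn u v = -1.
Proof.
move=> _; rewrite /assoc_sgn; case: ifP => [|_]; first exact: sgn_pm1.
exact: sigma_max_pm1.
Qed.

(* This is the associated signed complete graph K^{D^+-} only under the
   assumption Dmax = Dmin, i.e., when sigma_max and sigma_min agree. *)
Definition assoc_complete : signed_graph V :=
  SignedGraph assoc_adj_sym assoc_adj_irr assoc_sgn_sym assoc_sgn_pm1.

End SignedGraphs.

Definition is_largest_eigenvalue (R : realFieldType) (n : nat)
    (A : 'M[R]_n) (a : R) : Prop :=
  eigenvalue A a /\ forall b, eigenvalue A b -> b <= a.

(* The multiset of the entries of s is the spectrum of A, counted with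
   algebraic multiplicities. *)
Definition has_spectrum (R : comNzRingType) (n : nat)
    (A : 'M[R]_n) (s : seq R) : Prop :=
  char_poly A = \prod_(a <- s) ('X - a%:P).

(* Main.v *)
Require Import Defs.
From mathcomp Require Import all_boot all_order all_algebra.
From mathcomp Require Import zify ring.

(** Both spectral conditions say that the associated complete graph can be
    switched to the all-positive one, and so does balance.

    A switching of a signed graph is a function t with values +1 and -1 such
    that every edge uv has sign t u * t v.  The sign of a path is then
    determined by its ends, so cycles are positive; conversely, in a connected
    balanced graph every closed walk is positive ([balanced_closed_walk]), and
    the signs of walks from a fixed root form a switching
    ([balanced_switching]).

    A switching t of a connected graph also makes all shortest uv-paths have
    sign t u * t v, so both signed distance matrices agree and t still switches
    the associated complete graph ([switching_assoc]).  The adjacency matrix of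
    that graph is therefore t^T t - I, a rank one perturbation of -I, whose
    characteristic polynomial comes from the determinant identity
    [det_rank1_update]; it shows the spectrum, and that n - 1 is the largest
    eigenvalue.

    It remains to recover a switching from the eigenvalue n - 1 alone
    ([complete_eigenvalue_switching]).  If f is an eigenvector, then
      sum over u != v of (f v - sgn u v * f u)^2
        = 2 (n-1) |f|^2 - 2 f A f^T = 0,
    so f v = sgn u v * f u for all u != v, and f is, up to a scalar, a
    switching.  Its restriction to the edges of the original graph shows that
    graph to be balanced. *)

Set Implicit Arguments.
Unset Strict Implicit.
Unset Printing Implicit Defensive.

Import Order.TTheory GRing.Theory Num.Theory.
Local Open Scope ring_scope.

(** * Switchings and balance *)

Lemma repeat_split (T : eqType) (p : seq T) : ~~ uniq p ->
  exists x p1 p2 p3, p = rcons p1 x ++ rcons p2 x ++ p3.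
Proof.
elim: p => //= y p IH; rewrite negb_and negbK.
have [yp _|_ /IH] := boolP (y \in p).
  case/splitPr: yp => p2 p3; exists y, [::], p2, p3.
  by rewrite !cat_rcons.
by case=> x [p1] [p2] [p3] ->; exists x, (y :: p1), p2, p3.
Qed.

Section Switching.
Variables (V : finType) (S : signed_graph V).
Implicit Types (u v : V) (p c : seq V).

Definition switching (t : V -> int) : Prop :=
  (forall v, t v = 1 \/ t v = -1) /\
  (forall u v, adj S u v -> sgn S u v = t u * t v).

Lemma pm1_sqr (a : int) : a = 1 \/ a = -1 -> a * a = 1.
Proof. by case=> ->. Qed.

Lemma pm1_mul (a b : int) :
  a = 1 \/ a = -1 -> b = 1 \/ b = -1 -> a * b = 1 \/ a * b = -1.
Proof. by case=> ->; case=> ->; [left|right|right|left]. Qed.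

Lemma path_sign_cat u p q :
  path_sign S u (p ++ q) = path_sign S u p * path_sign S (last u p) q.
Proof.
elim: p u => [|x p IH] u /=; first by rewrite {2}/path_sign big_nil mul1r.
by rewrite !path_sign_cons IH mulrA.
Qed.

Lemma path_sign_pm1 u p :
  path (adj S) u p -> path_sign S u p = 1 \/ path_sign S u p = -1.
Proof.
elim: p u => [|x p IH] u /=; first by left; rewrite /path_sign big_nil.
case/andP=> ux xp; rewrite path_sign_cons.
exact: pm1_mul (sgn_pm1 ux) (IH _ xp).
Qed.

Lemma switching_path_sign t u p : switching t -> path (adj S) u p ->
  path_sign S u p = t u * t (last u p).
Proof.
case=> t1 tS; elim: p u => [|x p IH] u /=.
  by rewrite /path_sign big_nil pm1_sqr.
case/andP=> ux xp; rewrite path_sign_cons IH // (tS _ _ ux).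
by rewrite mulrA -(mulrA (t u)) pm1_sqr // mulr1.
Qed.

Lemma cycle_sign_path u q : uniq (u :: q) ->
  cycle_sign S (u :: q) = path_sign S u (rcons q u).
Proof.
move=> uq; rewrite /cycle_sign /path_sign (big_nth u) [RHS](big_nth 0).
rewrite size_pairmap size_rcons; apply: eq_big_nat => i /andP[_ lti].
rewrite (nth_pairmap u) ?size_rcons // next_nth mem_nth // index_uniq //.
rewrite -rcons_cons !nth_rcons /= lti.
(* The closing vertex u doubles as the default value of nth. *)
by case: ltnP => // le_q_i; rewrite if_same (nth_default u le_q_i).
Qed.

Lemma switching_balanced t : switching t -> balanced S.
Proof.
move=> tS [|u q] /and3P[_ cq uq] //.
rewrite cycle_sign_path // (switching_path_sign tS) // last_rcons.
by apply: pm1_sqr; case: tS.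
Qed.

(** A closed walk that revisits a vertex splits there into two shorter closed
    walks; one that does not is a cycle, unless it has at most two edges, in
    which case it is trivial or traverses one edge back and forth. *)
Lemma balanced_closed_walk u p : balanced S ->
  path (adj S) u p -> last u p = u -> path_sign S u p = 1.
Proof.
move=> bal; have [n] := ubnP (size p); elim: n u p => // n IH u p ltp up lp.
have [uqp|/repeat_split[x [p1 [p2 [p3 def_p]]]]] := boolP (uniq p); last first.
  move: ltp up lp; rewrite {}def_p !cat_path !last_cat !last_rcons !size_cat.
  rewrite !size_rcons => ltp /and3P[w1 w2 w3] lp.
  rewrite !path_sign_cat !last_rcons [path_sign S x _]IH ?last_rcons //; last first.
    by rewrite size_rcons; lia.
  rewrite mul1r -{2}[x](last_rcons u p1) -path_sign_cat.
  apply: IH; rewrite ?cat_path ?w1 ?last_cat ?last_rcons //.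
  by rewrite size_cat size_rcons; lia.
case/lastP: p uqp up lp {ltp} => [|q x]; first by rewrite /path_sign big_nil.
rewrite last_rcons rcons_uniq => uq up xu; move: uq up; rewrite {}xu => uq up.
rewrite -cycle_sign_path //.
case: q uq up => [|v [|w q]] uq up.
- by rewrite /= adj_irr in up.
- rewrite cycle_sign_path // /= path_sign_cons path_sign_cons /path_sign big_nil.
  case/and3P: up => ux _ _; rewrite mulr1 -(sgn_sym ux).
  exact: pm1_sqr (sgn_pm1 ux).
- by apply: bal; apply/and3P.
Qed.

Lemma balanced_switching : connected S -> balanced S -> exists t, switching t.
Proof.
case=> /card_gt0P[r _] conn bal.
pose w v := xchoose (conn r v).
have wP v : path (adj S) r (w v) /\ last r (w v) = v.
  by case/and3P: (xchooseP (conn r v)) => rv _ /eqP.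
pose t v := path_sign S r (w v).
have t1 v : t v = 1 \/ t v = -1 by apply: path_sign_pm1; case: (wP v).
exists t; split=> // u v uv.
have [[ru lu] [rv lv]] := (wP u, wP v).
have rvu : path (adj S) v (rev (belast r (w v))).
  rewrite -{1}lv rev_path (eq_path (e' := adj S)) // => x y.
  by rewrite /= adj_sym.
(* Out from the root to u, across the edge uv, and back from v. *)
have := @balanced_closed_walk r (w u ++ v :: rev (belast r (w v))) bal.
rewrite cat_path ru last_cat lu /= uv rvu path_sign_cat lu path_sign_cons.
have -> : last v (rev (belast r (w v))) = r.
  by case: (w v) lv => //= x q _; rewrite rev_cons last_rcons.
have -> : path_sign S v (rev (belast r (w v))) = t v.
  by rewrite -{1}lv path_sign_rev.
move=> /(_ isT erefl) /(congr1 (fun a => t u * a * t v)).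
rewrite -/(t u) mulr1 => <-; rewrite !mulrA pm1_sqr // mul1r.
by rewrite -mulrA pm1_sqr // mulr1.
Qed.

(** * Switchings of the associated complete graph *)

Lemma shortest_path_exists u v : connected S ->
  exists p : (dist S u v).-tuple V, is_path S u v p.
Proof.
case=> _ /(_ u v)[p pp].
have has_p : has (has_path_of_length S u v) (iota 0 #|V|).
  apply/hasP; exists (size p); last by apply/existsP; exists (in_tuple p).
  case/and3P: pp => _ up _; rewrite mem_iota /=.
  by have := max_card [in u :: p]; rewrite (card_uniqP up).
have := nth_find 0%N has_p; rewrite nth_iota; first by rewrite add0n => /existsP.
by rewrite has_find size_iota in has_p.
Qed.

(** Connectedness rules out that the condition holds vacuously for both values
    of s. *)
Lemma switching_all_shortest_sign t u v s : connected S -> switching t ->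
  all_shortest_sign S u v s = (t u * t v == s).
Proof.
move=> conn tS; apply/forallP/idP => [H|tuv p]; last first.
  apply/implyP=> /and3P[up _ /eqP lp].
  by rewrite (switching_path_sign tS up) lp.
have [p pp] := shortest_path_exists u v conn.
have /implyP/(_ pp) := H p; case/and3P: pp => up _ /eqP lp.
by rewrite (switching_path_sign tS up) lp.
Qed.

Lemma switching_sigma t u v : connected S -> switching t ->
  sigma_max S u v = t u * t v /\ sigma_min S u v = t u * t v.
Proof.
move=> conn tS; rewrite /sigma_max /sigma_min.
rewrite !(switching_all_shortest_sign _ _ _ conn tS).
by case: tS => t1 _; case: (pm1_mul (t1 u) (t1 v)) => ->.
Qed.

Lemma switching_Dmax_Dmin t : connected S -> switching t -> Dmax S = Dmin S.
Proof.
move=> conn tS; apply/matrixP => i j; rewrite !mxE /d_max /d_min.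
by case: (switching_sigma (enum_val i) (enum_val j) conn tS) => -> ->.
Qed.

End Switching.

Lemma switching_assoc (V : finType) (S : signed_graph V) t :
  connected S -> switching S t -> switching (assoc_complete S) t.
Proof.
move=> conn tS; case: (tS) => t1 tE; split=> // u v _ /=.
rewrite /assoc_sgn; case: ifP => [/tE //|_].
by case: (switching_sigma u v conn tS).
Qed.

Lemma assoc_switching (V : finType) (S : signed_graph V) t :
  switching (assoc_complete S) t -> switching S t.
Proof.
case=> t1 tE; split=> // u v uv; rewrite -tE /= /assoc_sgn ?uv //.
by apply: contraTneq uv => ->; rewrite adj_irr.
Qed.

(** * The spectrum of a switched complete graph *)

(** Clear the lower left block of the matrix with rows (1, t) and (t^T, aI) in
    two ways.  Row operations leave the blocks 1 and aI - t^T t on the diagonal;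
    column operations, which first multiply the left column by a, leave
    a - t t^T and aI.  That multiplication is the extra factor a on the left. *)
Lemma det_rank1_update (R : comNzRingType) n (t : 'rV[R]_n) (a : R) :
  \det (a%:M - t^T *m t) * a = (a - (t *m t^T) 0 0) * a ^+ n.
Proof.
pose M := block_mx (1%:M : 'M_1) t t^T (a%:M : 'M_n).
have detM : \det M = \det (a%:M - t^T *m t).
  have -> : M = block_mx 1%:M 0 t^T 1%:M *m
                block_mx (1%:M : 'M_1) t 0 (a%:M - t^T *m t).
    rewrite mulmx_block !mul1mx !mul0mx !mulmx1 !addr0.
    by rewrite addrC subrK.
  by rewrite det_mulmx det_lblock det_ublock !det1 !mul1r.
rewrite -detM.
pose N := block_mx (a%:M : 'M_1) 0 (- t^T) (1%:M : 'M_n).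
have detN : \det N = a by rewrite det_lblock det1 mulr1 det_scalar.
rewrite -{1}detN -det_mulmx mulmx_block !mul1mx !mulmx1 !mulmx0 !add0r.
rewrite mul_mx_scalar mul_scalar_mx scalerN subrr det_ublock det_scalar.
by rewrite det_mx11 mulmxN !mxE eqxx mulr1n.
Qed.

Definition complete (V : finType) (T : signed_graph V) : Prop :=
  forall u v, adj T u v = (u != v).

Lemma complete_switching_spectrum (R : idomainType) (V : finType)
    (T : signed_graph V) t : (0 < #|V|)%N -> complete T -> switching T t ->
  has_spectrum (adjacency_matrix T R)
    ((#|V|%:R - 1) :: nseq (#|V| - 1) (-1)).
Proof.
move=> V0 cT [t1 tE]; rewrite /has_spectrum big_cons big_nseq iter_mulr_1.
pose w : 'rV[{poly R}]_#|V| := \row_i ((t (enum_val i))%:~R).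
have ww : (w *m w^T) 0 0 = #|V|%:R.
  rewrite mxE (eq_bigr (fun=> 1)) => [|i _].
    by rewrite sumr_const card_ord.
  by rewrite !mxE -intrM pm1_sqr.
have a0 : 'X - (-1)%:P != 0 :> {poly R} by rewrite polyXsubC_eq0.
apply: (mulIf a0); rewrite -mulrA -exprSr subn1 prednK //.
have -> : char_poly (adjacency_matrix T R) =
          \det (('X - (-1)%:P)%:M - w^T *m w).
  congr (\det _); apply/matrixP => i j; rewrite !mxE big_ord1 !mxE.
  rewrite cT (inj_eq enum_val_inj) -intrM; have [->|ij] /= := eqVneq i j.
    by rewrite pm1_sqr // !mulr1n polyC0 polyCN subr0 opprK addrK.
  by rewrite tE ?cT ?(inj_eq enum_val_inj) // !mulr0n !sub0r rmorph_int.
rewrite det_rank1_update ww; congr (_ * _).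
by rewrite polyCN polyCB !polyC1 polyC_natr; ring.
Qed.

Lemma spectrum_largest_eigenvalue (R : realFieldType) n (A : 'M[R]_n) a s :
  has_spectrum A (a :: s) -> all (fun b => b <= a) s ->
  is_largest_eigenvalue A a.
Proof.
move=> spA /allP les; split=> [|b]; rewrite eigenvalue_root_char spA root_prod_XsubC.
  exact: mem_head.
by rewrite inE => /predU1P[->|/les].
Qed.

(** * From the eigenvalue n - 1 to a switching *)

Lemma adjacency_eigenvalueP (R : fieldType) (V : finType) (T : signed_graph V)
    (a : R) : eigenvalue (adjacency_matrix T R) a ->
  exists2 f : V -> R, (exists v, f v != 0) &
    forall v, \sum_(u | adj T u v) (sgn T u v)%:~R * f u = a * f v.
Proof.
case/eigenvalueP=> x xA x0; exists (fun v => x 0 (enum_rank v)).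
  by have /rV0Pn[i xi] := x0; exists (enum_val i); rewrite enum_valK.
move=> v; have /rowP/(_ (enum_rank v)) := xA; rewrite !mxE => <-.
rewrite (reindex (enum_val : 'I_#|V| -> V)) /=; last by apply: onW_bij; apply: enum_val_bij.
rewrite big_mkcond; apply: eq_bigr => i _; rewrite !mxE enum_rankK enum_valK.
by case: ifP; rewrite ?mulr0 // mulrC.
Qed.

(** Expanding the squares (f v - sgn u v * f u)^2 for fixed v and using the
    eigenvalue equation leaves the sum of f u ^ 2 over u != v minus
    (n - 1) * f v ^ 2, and these differences cancel when summed over v. *)
Lemma complete_eigenfunction (R : realFieldType) (V : finType)
    (T : signed_graph V) (f : V -> R) : complete T ->
  (forall v, \sum_(u | adj T u v) (sgn T u v)%:~R * f u
             = (#|V|%:R - 1) * f v) ->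
  forall u v, u != v -> f v = (sgn T u v)%:~R * f u.
Proof.
move=> cT fE.
pose g u v := (f v - (sgn T u v)%:~R * f u) ^+ 2.
have deg v (b : R) : \sum_(u | adj T u v) b = (#|V|%:R - 1) * b.
  rewrite sumr_const (eq_card (B := predC1 v)); last by move=> u; apply: cT.
  have V0 : (0 < #|V|)%N by apply/card_gt0P; exists v.
  by rewrite cardC1 -(prednK V0) mulrSr addrK -mulr_natl.
have sum0 : \sum_v \sum_(u | adj T u v) g u v = 0.
  have gE v : \sum_(u | adj T u v) g u v =
      \sum_(u | adj T u v) f u ^+ 2 - (#|V|%:R - 1) * f v ^+ 2.
    transitivity (\sum_(u | adj T u v)
       (f v ^+ 2 - 2 * f v * ((sgn T u v)%:~R * f u) + f u ^+ 2)).
      apply: eq_bigr => u uv; rewrite /g.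
      by case: (sgn_pm1 uv) => ->; rewrite ?mulrN1z; ring.
    by rewrite big_split sumrB /= deg -mulr_sumr fE; ring.
  rewrite (eq_bigr _ (fun v _ => gE v)) sumrB.
  rewrite (exchange_big_dep xpredT) //= -sumrB big1 // => u _.
  by under eq_bigl do rewrite adj_sym; rewrite deg subrr.
move=> u v uv.
have g0 x y : 0 <= g x y by apply: sqr_ge0.
have := psumr_eq0P (fun y _ => sumr_ge0 _ (fun x _ => g0 x y)) sum0 (i := v) isT.
move=> /(psumr_eq0P (fun x _ => g0 x v))/(_ u); rewrite cT => /(_ uv)/eqP.
by rewrite sqrf_eq0 subr_eq0 => /eqP.
Qed.

(** An eigenfunction f is determined by its value at one vertex k where it does
    not vanish; dividing by f k gives the switching t, which therefore has
    t k = 1 and t v = sgn k v elsewhere. *)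
Lemma complete_eigenvalue_switching (R : realFieldType) (V : finType)
    (T : signed_graph V) : complete T ->
  eigenvalue (adjacency_matrix T R) (#|V|%:R - 1) -> exists t, switching T t.
Proof.
move=> cT /adjacency_eigenvalueP[f [k fk] /(complete_eigenfunction cT) fE].
pose t v := if v == k then 1 else sgn T k v.
have ft v : f v = (t v)%:~R * f k.
  by rewrite /t; case: eqVneq => [->|vk]; rewrite ?mul1r // (fE k) // eq_sym.
exists t; split=> [v|u v].
  by rewrite /t; case: eqVneq => [_|vk]; [left|apply: sgn_pm1; rewrite cT eq_sym].
have t1 : t u * t u = 1.
  rewrite /t; case: eqVneq => // uk.
  by apply/pm1_sqr/sgn_pm1; rewrite cT eq_sym.
rewrite cT => /fE; rewrite (ft u) (ft v) mulrA => /(mulIf fk).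
by rewrite -intrM => /intr_inj ->; rewrite mulrCA t1 mulr1.
Qed.

(** * The equivalence *)

Theorem theorem3p2 (R : rcfType) (V : finType) (S : signed_graph V) (n : nat)
    (hn : #|V| = n) (hconn : connected S) :
  [<-> balanced S;
       Dmax S = Dmin S /\
         is_largest_eigenvalue (adjacency_matrix (assoc_complete S) R)
           (n%:R - 1);
       Dmax S = Dmin S /\
         has_spectrum (adjacency_matrix (assoc_complete S) R)
           ((n%:R - 1) :: nseq (n - 1) (-1))].
Proof.
subst n; have V0 := hconn.1.
have spectrum t : switching (assoc_complete S) t ->
    has_spectrum (adjacency_matrix (assoc_complete S) R)
      ((#|V|%:R - 1) :: nseq (#|V| - 1) (-1)).
  exact: complete_switching_spectrum.
have eigen_switching :
    eigenvalue (adjacency_matrix (assoc_complete S) R) (#|V|%:R - 1) ->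
    exists t, switching (assoc_complete S) t.
  exact: complete_eigenvalue_switching.
have le_n1 : all (fun b : R => b <= #|V|%:R - 1) (nseq (#|V| - 1) (-1)).
  by apply/allP=> b; rewrite mem_nseq => /andP[_ /eqP ->]; rewrite lerBrDr addNr.
tfae.
- case/(balanced_switching hconn)=> t tS.
  split; first exact: switching_Dmax_Dmin tS.
  exact: spectrum_largest_eigenvalue (spectrum t (switching_assoc hconn tS)) le_n1.
- by case=> DD [/eigen_switching[t tS] _]; split; last exact: spectrum tS.
- case=> _ /spectrum_largest_eigenvalue/(_ le_n1)[/eigen_switching[t tS] _].
  exact: switching_balanced (assoc_switching tS).
Qed.
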